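(* Let $S$ be a standard graded polynomial ring over a field $k$ and let $I\subset S$ be a homogeneous ideal of height $c\geq 2$. If $I$ satisfies the condition $N_{d,c}$, then $$\binom{d+c-2}{c-1}\leq \beta_c(S/I).$$
   Context: $\beta_i(S/I)=\dim_k\mathrm{Tor}_i^S(k,S/I)$. Write $t_i^S(N)=\sup\{j\mid \mathrm{Tor}_i^S(k,N)_j\neq0\}$. For integers $d,q\geq 1$, a homogeneous ideal $I$ satisfies the condition $N_{d,q}$ if $I$ is generated in the single degree $d$ and $t_i^S(S/I)=d+i-1$ for all $1\leq i\leq q$. *)

(* Defs.v *)
From HB Require Import structures.
From mathcomp Require Import all_boot all_algebra.
From mathcomp Require Import mpoly.

Set Implicit Arguments.
Unset Strict Implicit.
Unset Printing Implicit Defensive.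

Import GRing.Theory.
Local Open Scope ring_scope.

(* Ideals are MathComp's [idealr] (boolean, proper) predicates.  Properness is
   harmless here: the unit ideal contains no prime, hence has no finite height,
   and it is not generated in a single positive degree either. *)

Section Ideals.

Variable R : comNzRingType.

Definition ssubset_pred (A B : {pred R}) : Prop :=
  {subset A <= B} /\ exists2 x, x \in B & x \notin A.

(* P is the top of a strictly increasing chain P_0 < P_1 < ... < P_l = P of
   primes, i.e. the height of P is at least l. *)
Definition prime_height_ge (P : prime_idealr R) (l : nat) : Prop :=
  exists C : nat -> prime_idealr R,
    (forall i, (i < l)%N -> ssubset_pred (C i) (C i.+1)) /\ C l =i P.

(* The height of I is the minimum of the heights of the primes containing I. *)
Definition has_height (I : idealr R) (c : nat) : Prop :=
  (forall P : prime_idealr R, {subset I <= P} -> prime_height_ge P c)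
  /\ (exists P : prime_idealr R,
        {subset I <= P} /\ ~ prime_height_ge P c.+1).

End Ideals.

Section GradedModules.

Variables (k : fieldType) (n : nat).
Local Notation S := {mpoly k[n]}.

Definition homogeneous_ideal (I : idealr S) : Prop :=
  forall (p : S) (j : nat), p \in I -> pihomog mdeg j p \in I.

Definition generated_in_degree (I : idealr S) (d : nat) : Prop :=
  forall p, p \in I ->
  exists (m : nat) (g a : 'I_m -> S),
    (forall l, g l \in I /\ g l \is d.-homog) /\ p = \sum_l a l * g l.

(* F_i = (+)_b S(- gdeg i b), b < rk i, with elements written as row vectors;
   [dif i] is the matrix of F_{i+1} -> F_i, acting on the right, and [aug]
   lists lifts to S of the images in S/I of the basis of F_0. *)
Record free_seq := FreeSeq {
  rk : nat -> nat;
  gdeg : forall i, 'I_(rk i) -> nat;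
  dif : forall i, 'M[S]_(rk i.+1, rk i);
  aug : 'cV[S]_(rk 0)
}.

(* All maps are homogeneous of degree 0, and
   ... -> F_1 -> F_0 -> S/I -> 0 is exact. *)
Definition graded_free_resolution (I : idealr S) (F : free_seq) : Prop :=
  [/\ forall i a b m, m \in msupp (dif F i a b) ->
        (mdeg m + gdeg (f := F) b = gdeg (f := F) a)%N,
      forall b, aug F b 0 \is (gdeg (f := F) b).-homog,
      exists v : 'rV[S]_(rk F 0), 1 - (v *m aug F) 0 0 \in I,
      forall v : 'rV[S]_(rk F 0),
        (v *m aug F) 0 0 \in I <-> exists w, v = w *m dif F 0
    & forall i (v : 'rV[S]_(rk F i.+1)),
        v *m dif F i = 0 <-> exists w, v = w *m dif F i.+1].

(* The complex k (x)_S F, where k = S/(x_1, ..., x_n): S -> k takes the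
   constant coefficient. *)
Definition tdif (F : free_seq) (i : nat) : 'M[k]_(rk F i.+1, rk F i) :=
  map_mx (mcoeff 0%MM) (dif F i).

Definition tcycles (F : free_seq) (i : nat) : 'M[k]_(rk F i) :=
  match i with
  | 0 => 1%:M
  | i'.+1 => kermx (tdif F i')
  end.

(* The degree j component of k (x)_S F_i. *)
Definition tpiece (F : free_seq) (i j : nat) : 'M[k]_(rk F i) :=
  diag_mx (\row_b (gdeg (f := F) b == j)%:R).

(* Tor_i^S(k, S/I) = H_i(k (x)_S F) and its degree j component, for F a graded
   free resolution of S/I.  [A :\: B] is a complement of A :&: B in A, so its
   rank is the dimension of A / (A :&: B). *)
Definition betti (F : free_seq) (i : nat) : nat :=
  \rank (tcycles F i :\: tdif F i)%MS.

Definition tor_dim (F : free_seq) (i j : nat) : nat :=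
  \rank ((tcycles F i :&: tpiece F i j) :\: (tdif F i :&: tpiece F i j))%MS.

(* t_i^S(S/I) = t.  A supremum of a set of degrees that is a finite number is
   attained; the supremum of the empty set is not a finite number. *)
Definition has_max_shift (F : free_seq) (i t : nat) : Prop :=
  tor_dim F i t != 0%N /\ forall j, tor_dim F i j != 0%N -> (j <= t)%N.

Definition condition_N (I : idealr S) (F : free_seq) (d q : nat) : Prop :=
  generated_in_degree I d
  /\ forall i, (1 <= i <= q)%N -> has_max_shift F i (d + i - 1).

End GradedModules.

(* Main.v *)
(* Let phi : k[x_1..x_n] -> R = K[z_1..z_c], x_j |-> \sum_i t_ji z_i, be a generic
   linear specialisation, with the t_ji algebraically independent over k.  Since
   I has height at least c, some power z_i^N of every variable lies in phi(I)R.
   An element of I acts null-homotopically on F, hence so does every z_i^N on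
   F' = R (x) F.  If h is the homotopy for z_j^N, then u |-> u h maps the homology
   of F' modulo (z_1^N, ..., z_(j-1)^N) injectively into that modulo one more
   power, one homological degree higher, as z_j^N is a regular element.  After c
   steps, H_0(F') in degree d - 1, which is R_(d-1) because I starts in degree d,
   embeds into H_c(F' / (z_1^N, ..., z_c^N)) in degree d - 1 + cN.  As Tor_c lives
   in degrees at most d + c - 1 and the socle of R/(z_1^N, ..., z_c^N) has
   dimension one and degree c(N - 1), the latter space has dimension at most
   beta_c(S/I).  Finally dim R_(d-1) = binom(d + c - 2, c - 1). *)
Require Import Defs.
From HB Require Import structures.
From mathcomp Require Import all_boot all_algebra.
From mathcomp Require Import mpoly zify ring.
From mathcomp Require boolp classical_sets.

Set Implicit Arguments.
Unset Strict Implicit.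
Unset Printing Implicit Defensive.

Import GRing.Theory.
Local Open Scope ring_scope.

(** * Graded matrices over polynomial rings *)

Section Filter.

Variables (n : nat) (R : comNzRingType).
Implicit Types (p q : {mpoly R[n]}) (P : pred 'X_{1..n}) (m : 'X_{1..n}).

Definition mfilter P p : {mpoly R[n]} :=
  \sum_(m <- msupp p | P m) p@_m *: 'X_[m].

Lemma mcoeff_mfilter P p m : (mfilter P p)@_m = if P m then p@_m else 0.
Proof.
rewrite /mfilter raddf_sum /=.
under eq_bigr => k _ do rewrite mcoeffZ mcoeffX.
have [pm|pm] := boolP (m \in msupp p).
  rewrite big_mkcond (bigD1_seq m) ?msupp_uniq //= big1 ?addr0.
    by rewrite eqxx mulr1.
  by move=> k /negPf ->; rewrite mulr0 if_same.
rewrite big_seq_cond big1 ?(memN_msupp_eq0 pm) ?if_same // => k /andP[kp _].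
by case: eqP => [kE|_]; rewrite ?mulr0 //; rewrite -kE kp in pm.
Qed.

Lemma msupp_mfilter P p m : m \in msupp (mfilter P p) -> P m /\ m \in msupp p.
Proof. by rewrite !mcoeff_msupp mcoeff_mfilter; case: (P m); rewrite ?eqxx. Qed.

Lemma mfilter_id P p : {in msupp p, forall m, P m} -> mfilter P p = p.
Proof.
move=> Pp; apply/mpolyP => m; rewrite mcoeff_mfilter.
by case: ifPn => // /negP nP; case: (boolP (m \in msupp p)) => [/Pp|/memN_msupp_eq0].
Qed.

Lemma mfilter0 P : mfilter P 0 = 0.
Proof. by apply/mpolyP => m; rewrite mcoeff_mfilter mcoeff0 if_same. Qed.

Lemma mfilterD P : {morph mfilter P : p q / p + q}.
Proof.
move=> p q; apply/mpolyP => m; rewrite mcoeffD !mcoeff_mfilter mcoeffD.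
by case: ifP; rewrite ?addr0.
Qed.

Lemma mfilter_sum P (T : Type) (r : seq T) (F : T -> {mpoly R[n]}) :
  mfilter P (\sum_(t <- r) F t) = \sum_(t <- r) mfilter P (F t).
Proof. exact: (big_morph _ (mfilterD P) (mfilter0 P)). Qed.

(** Typically [P] is a degree condition and [q] is homogeneous: all monomials of [q] then shift [P]
    to the same [P']. *)
Lemma mfilterMr P P' p q :
  {in msupp q, forall m2, forall m1, P (m1 + m2)%MM = P' m1} ->
  mfilter P (p * q) = mfilter P' p * q.
Proof.
move=> PP'; apply/mpolyP => m; rewrite mcoeff_mfilter !mcoeffM.
have -> (x : R) : (if P m then x else 0) = (if P m then 1 else 0) * x.
  by case: ifP; rewrite ?mul1r ?mul0r.
rewrite mulr_sumr; apply: eq_bigr => k /eqP mE.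
rewrite mcoeff_mfilter mulrA; have [qk|/memN_msupp_eq0 ->] := boolP (val k.2 \in msupp q).
  by move: (PP' _ qk k.1); rewrite -mE => ->; case: ifP; rewrite ?mul1r ?mul0r.
by rewrite !mulr0.
Qed.

Lemma mcoeffM_eq0 p q m :
  (forall m', (m' <= m)%MM -> p@_m' = 0) -> (p * q)@_m = 0.
Proof.
move=> p0; rewrite mcoeffM big1 // => k /eqP mE.
by rewrite p0 ?mul0r //; move: (lem_addr k.1 k.2); rewrite -mE.
Qed.

(** In the convolution only the pair formed by [m] and the empty monomial survives. *)
Lemma mcoeffM_lowest p q m :
  (forall m', (m' <= m)%MM -> m' != m -> p@_m' = 0) ->
  (p * q)@_m = p@_m * q@_0%MM.
Proof.
move=> p0; rewrite -[p in LHS](subrK (p@_m *: 'X_[m])) mulrDl mcoeffD.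
rewrite mcoeffM_eq0 ?add0r; last first.
  move=> m' lem'; rewrite mcoeffB mcoeffZ mcoeffX eq_sym.
  by case: eqP => [->|/eqP /p0 ->]; rewrite ?mulr1 ?mulr0 ?subrr ?subr0.
rewrite -scalerAl mcoeffZ; congr (_ * _).
by rewrite mulrC -[X in _@_X]addm0 mcoeffMX.
Qed.

End Filter.

Section GradedMatrices.

Variables (n : nat) (R : comNzRingType).
Local Notation S := {mpoly R[n]}.

(* A maps the free module with basis degrees ga to the one with basis degrees
   gb, raising degrees by s. *)
Definition homog_mx p q (ga : 'I_p -> nat) (gb : 'I_q -> nat) s
    (A : 'M[S]_(p, q)) : Prop :=
  forall a b m, m \in msupp (A a b) -> (mdeg m + gb b = ga a + s)%N.

(** This projection makes solutions of linear equations homogeneous: it fixes homogeneous matrices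
    and commutes with products by matrices of degree 0. *)
Definition homog_part p q (ga : 'I_p -> nat) (gb : 'I_q -> nat) s
    (A : 'M[S]_(p, q)) : 'M[S]_(p, q) :=
  \matrix_(a, b) mfilter (fun m => (mdeg m + gb b == ga a + s)%N) (A a b).

Lemma homog_partP p q ga gb s (A : 'M[S]_(p, q)) :
  homog_mx ga gb s (homog_part ga gb s A).
Proof. by move=> a b m; rewrite mxE => /msupp_mfilter[/eqP]. Qed.

Lemma homog_part_id p q ga gb s (A : 'M[S]_(p, q)) :
  homog_mx ga gb s A -> homog_part ga gb s A = A.
Proof.
move=> hA; apply/matrixP => a b; rewrite mxE mfilter_id // => m /hA ->.
exact: eqxx.
Qed.

Lemma homog_partD p q ga gb s :
  {morph @homog_part p q ga gb s : A B / A + B}.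
Proof. by move=> A B; apply/matrixP => a b; rewrite !mxE mfilterD. Qed.

Lemma homog_part_mulr p q r ga gb gc s (A : 'M[S]_(p, q)) (B : 'M[S]_(q, r)) :
  homog_mx gb gc 0 B ->
  homog_part ga gc s (A *m B) = homog_part ga gb s A *m B.
Proof.
move=> hB; apply/matrixP => a b; rewrite !mxE mfilter_sum; apply: eq_bigr => k _.
rewrite mxE; apply: mfilterMr => m2 /hB; rewrite addn0 => gE m1.
by rewrite mdegD -addnA gE.
Qed.

Lemma homog_part_mull p q r ga gb gc s (A : 'M[S]_(p, q)) (B : 'M[S]_(q, r)) :
  homog_mx ga gb 0 A ->
  homog_part ga gc s (A *m B) = A *m homog_part gb gc s B.
Proof.
move=> hA; apply/matrixP => a b; rewrite !mxE mfilter_sum; apply: eq_bigr => k _.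
rewrite mxE ![A a k * _]mulrC; apply: mfilterMr => m2 /hA; rewrite addn0 => gE m1.
by rewrite mdegD -gE addnAC addnC -[X in _ == X]addnA eqn_add2l.
Qed.

Lemma homog_mx_mul p q r ga gb gc s s' (A : 'M[S]_(p, q)) (B : 'M[S]_(q, r)) :
  homog_mx ga gb s A -> homog_mx gb gc s' B -> homog_mx ga gc (s + s') (A *m B).
Proof.
move=> hA hB a b m; rewrite mxE mcoeff_msupp raddf_sum /= => /eqP nz.
case: (pickP (fun k => (A a k * B k b)@_m != 0)) => [k|z]; last first.
  by case: nz; rewrite big1 // => k _; apply/eqP/negbFE/z.
rewrite -mcoeff_msupp => /msuppM_le /allpairsP[[m1 m2] /= [/hA h1 /hB h2 ->]].
by rewrite mdegD -addnA h2 addnA h1 addnA.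
Qed.

Lemma homog_scalar_mx p (ga : 'I_p -> nat) s (y : S) :
  y \is s.-homog -> homog_mx ga ga s y%:M.
Proof.
move=> /dhomogP hy a b m; rewrite !mxE; case: eqP => [->|_].
  by rewrite mulr1n addnC => /hy ->.
by rewrite mulr0n msupp0.
Qed.

End GradedMatrices.

(** * Homotopies for powers of the variables *)

Section PowerIdeals.

Variables (c : nat) (R : comNzRingType) (N : nat).
Local Notation S := {mpoly R[c]}.

(* Membership in the ideal (x_i^N : i < j). *)
Definition pow_mnm (j : nat) (m : 'X_{1..c}) : bool :=
  [exists i : 'I_c, (i < j)%N && (N <= m i)%N].

Definition pow_ideal (j : nat) (p : S) : Prop :=
  forall m, ~~ pow_mnm j m -> p@_m = 0.

Lemma pow_mnm_dvd j m m' : (m' <= m)%MM -> ~~ pow_mnm j m -> ~~ pow_mnm j m'.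
Proof.
move=> /mnm_lepP lem; apply: contra => /existsP[i /andP[ij Ni]].
by apply/existsP; exists i; rewrite ij (leq_trans Ni).
Qed.

Lemma pow_ideal0 j : pow_ideal j 0.
Proof. by move=> m _; rewrite mcoeff0. Qed.

Lemma pow_idealD j p q : pow_ideal j p -> pow_ideal j q -> pow_ideal j (p + q).
Proof. by move=> hp hq m hm; rewrite mcoeffD hp // hq // addr0. Qed.

Lemma pow_idealN j p : pow_ideal j p -> pow_ideal j (- p).
Proof. by move=> hp m hm; rewrite mcoeffN hp // oppr0. Qed.

Lemma pow_idealMr j p q : pow_ideal j p -> pow_ideal j (p * q).
Proof.
move=> hp m hm; apply: mcoeffM_eq0 => m' lem; apply: hp.
exact: pow_mnm_dvd lem hm.
Qed.

Lemma pow_ideal_sum j (T : Type) (r : seq T) (F : T -> S) :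
  (forall t, pow_ideal j (F t)) -> pow_ideal j (\sum_(t <- r) F t).
Proof.
by move=> hF; elim/big_rec: _ => [|t p _ hp]; [exact: pow_ideal0|exact: pow_idealD].
Qed.

Lemma pow_idealS j p : pow_ideal j p -> pow_ideal j.+1 p.
Proof.
move=> hp m hm; apply: hp; apply: contra hm => /existsP[i /andP[ij Ni]].
by apply/existsP; exists i; rewrite Ni ltnS ltnW.
Qed.

(** The generators are powers of variables of index below [i], so multiplying a monomial by a power
    of x_i does not affect its membership. *)
Lemma pow_ideal_colon (i : 'I_c) p :
  pow_ideal i ('X_i ^+ N * p) -> pow_ideal i p.
Proof.
rewrite mpolyXn mulrC => hp m hm; rewrite -(mcoeffMX p (U_(i) *+ N)%MM) hp //.
apply: contra hm => /existsP[i' /andP[i'i Ni]].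
apply/existsP; exists i'; rewrite i'i; move: Ni; rewrite mnmDE mulmnE mnm1E.
by case: eqP => [ii|_]; rewrite ?addn0 // -ii ltnn in i'i *.
Qed.

Lemma pow_idealSP (i : 'I_c) p :
  pow_ideal i.+1 p -> exists b, pow_ideal i (p - 'X_i ^+ N * b).
Proof.
move=> hp; exists (\sum_(m <- msupp p | (N <= m i)%N) p@_m *: 'X_[m - U_(i) *+ N]).
rewrite mulr_sumr; under eq_bigr => m Nm.
  rewrite -scalerAr mpolyXn -mpolyXD addmC submK; first over.
  by apply/mnm_lepP => i'; rewrite mulmnE mnm1E; case: eqP => // <-; rewrite mul1n.
rewrite -/(mfilter (fun m => (N <= m i)%N) p) => m hm.
rewrite mcoeffB mcoeff_mfilter; case: leqP => Nm; first exact: subrr.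
rewrite subr0 hp //; apply: contra hm => /existsP[i' /andP[]].
rewrite ltnS leq_eqVlt => /orP[/eqP/val_inj ->|i'i Ni]; first by rewrite leqNgt Nm.
by apply/existsP; exists i'; rewrite i'i.
Qed.

Definition pow_mx j p q (A : 'M[S]_(p, q)) : Prop :=
  forall a b, pow_ideal j (A a b).

Lemma pow_mx0 j p q : pow_mx j (0 : 'M_(p, q)).
Proof. by move=> a b; rewrite mxE; exact: pow_ideal0. Qed.

Lemma pow_mxD j p q (A B : 'M_(p, q)) :
  pow_mx j A -> pow_mx j B -> pow_mx j (A + B).
Proof. by move=> hA hB a b; rewrite mxE; exact: pow_idealD. Qed.

Lemma pow_mxN j p q (A : 'M_(p, q)) : pow_mx j A -> pow_mx j (- A).
Proof. by move=> hA a b; rewrite mxE; exact: pow_idealN. Qed.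

Lemma pow_mxB j p q (A B : 'M_(p, q)) :
  pow_mx j A -> pow_mx j B -> pow_mx j (A - B).
Proof. by move=> hA /pow_mxN; exact: pow_mxD. Qed.

Lemma pow_mxS j p q (A : 'M_(p, q)) : pow_mx j A -> pow_mx j.+1 A.
Proof. by move=> hA a b; exact: pow_idealS. Qed.

Lemma pow_mx_mulr j p q r (A : 'M_(p, q)) (B : 'M_(q, r)) :
  pow_mx j A -> pow_mx j (A *m B).
Proof.
by move=> hA a b; rewrite mxE; apply: pow_ideal_sum => k; exact: pow_idealMr.
Qed.

Lemma pow_mx_mull j p q r (A : 'M_(p, q)) (B : 'M_(q, r)) :
  pow_mx j B -> pow_mx j (A *m B).
Proof.
move=> hB a b; rewrite mxE; apply: pow_ideal_sum => k.
by rewrite mulrC; exact: pow_idealMr.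
Qed.

Lemma pow_mx_colon (i : 'I_c) j p q (A : 'M_(p, q)) : i = j :> nat ->
  pow_mx j ('X_i ^+ N *: A) -> pow_mx j A.
Proof. by move=> <- hA a b; apply: pow_ideal_colon; have := hA a b; rewrite mxE. Qed.

Lemma pow_mxSP (i : 'I_c) j p q (A : 'M_(p, q)) : i = j :> nat ->
  pow_mx j.+1 A -> exists B, pow_mx j (A - 'X_i ^+ N *: B).
Proof.
move=> <- hA.
have /fin_all_exists2[f fP _] (ab : 'I_p * 'I_q) : exists2 b,
    pow_ideal i (A ab.1 ab.2 - 'X_i ^+ N * b) & True.
  by have [b] := pow_idealSP (hA ab.1 ab.2); exists b.
by exists (\matrix_(a, b) f (a, b)) => a b; rewrite !mxE; exact: (fP (a, b)).
Qed.

Lemma pow_mx0E p q (A : 'M_(p, q)) : pow_mx 0 A -> A = 0.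
Proof.
move=> hA; apply/matrixP => a b; rewrite mxE; apply/mpolyP => m.
by rewrite mcoeff0 hA //; apply/existsPn.
Qed.

End PowerIdeals.

(** * Homology of the specialised complex modulo powers of the variables *)

Section Complex.

Variables (c : nat) (K : fieldType) (N : nat).
Local Notation S := {mpoly K[c.+1]}.
Variables (rk : nat -> nat) (gd : forall i, 'I_(rk i) -> nat).
Variable D : forall i, 'M[S]_(rk i.+1, rk i).
Hypothesis homogD : forall i, homog_mx (@gd i.+1) (@gd i) 0 (D i).
Hypothesis DD0 : forall i, D i.+1 *m D i = 0.
Variable h : nat -> forall i, 'M[S]_(rk i, rk i.+1).
Hypothesis homogh : forall j i, homog_mx (@gd i) (@gd i.+1) N (h j i).
Local Notation y j := ('X_(inord j : 'I_c.+1) ^+ N : S).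
Hypothesis h0 : forall j, (j <= c)%N -> h j 0 *m D 0 = (y j)%:M.
Hypothesis hS : forall j i, (j <= c)%N ->
  h j i.+1 *m D i.+1 + D i *m h j i = (y j)%:M.
Local Notation Q := (pow_mx N).

(* If u is a cycle modulo (x_0^N, ..., x_(j-1)^N), then u h is a cycle modulo
   the next power x_j^N, and (u h) D = x_j^N u; regularity of x_j^N makes the
   induced map on homology injective. *)
Lemma homotopy_step j (u : 'rV[S]_(rk j)) (H : 'M[S]_(rk j, rk j.+1)) :
  (j <= c)%N -> Q j (u *m H *m D j - y j *: u) ->
  (exists w, Q j.+1 (u *m H - w *m D j.+1)) ->
  exists w, Q j (u - w *m D j).
Proof.
move=> jc cyc [w]; have jE : (inord j : 'I_c.+1) = j :> nat by rewrite inordK.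
move=> /(pow_mxSP jE)[w' hw]; exists w'; apply: (pow_mx_colon jE).
have -> : y j *: (u - w' *m D j) =
    (u *m H - w *m D j.+1 - y j *: w') *m D j - (u *m H *m D j - y j *: u).
  rewrite !mulmxBl -[w *m _ *m _]mulmxA DD0 mulmx0 subr0 -scalemxAl scalerBr.
  by rewrite opprB [RHS]addrC addrA subrK.
by apply: pow_mxB => //; exact: pow_mx_mulr.
Qed.

(** Induces the [j]-fold composite of the injections on homology; the homotopy leaving homological
    degree [j] is the one for x_j^N. *)
Fixpoint hcomp j : 'M[S]_(rk 0, rk j) :=
  match j with 0 => 1%:M | j'.+1 => hcomp j' *m h j' j' end.

Lemma homog_hcomp j : homog_mx (@gd 0) (@gd j) (j * N) (hcomp j).
Proof.
elim: j => [|j IH] /=.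
  by apply: homog_scalar_mx; exact: dhomog1.
by rewrite mulSn addnC; exact: homog_mx_mul IH (@homogh j j).
Qed.

Lemma pow_mx_scale j p q (A : 'M[S]_(p, q)) : (j <= c)%N -> Q j.+1 (y j *: A).
Proof.
move=> jc a b; rewrite mxE; apply: pow_idealMr => m.
rewrite mpolyXn mcoeffX; case: eqP => // <- /negP[].
apply/existsP; exists (inord j).
by rewrite inordK ?ltnS // mulmnE mnm1E eqxx mul1n !leqnn.
Qed.

(** By the homotopy identity, the error at [j.+1] factors through [hcomp j.+1 *m D j]. By induction
    this is x_j^N times [hcomp j] modulo the earlier powers, so it vanishes once x_j^N joins
    them. *)
Lemma hcomp_cycle j : (j <= c)%N -> Q j (hcomp j.+1 *m D j - y j *: hcomp j).
Proof.
elim: j => [|j IH] jc.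
  by rewrite /= mul1mx h0 // scalemx1 subrr; exact: pow_mx0.
rewrite [hcomp _.+2]/= -[_ *m h _ _ *m D _]mulmxA.
have -> : h j.+1 j.+1 *m D j.+1 = (y j.+1)%:M - D j *m h j.+1 j.
  by rewrite -(hS j jc) addrK.
rewrite mulmxBr mul_mx_scalar addrAC subrr add0r; apply: pow_mxN.
rewrite mulmxA; apply: pow_mx_mulr.
rewrite -[_ *m D j](subrK (y j *: hcomp j)); apply: pow_mxD.
  by apply: pow_mxS; apply: IH; exact: ltnW.
by apply: pow_mx_scale; exact: ltnW.
Qed.

(** Each use of [homotopy_step] gives up one power; with no power left, congruence is equality. *)
Lemma hcomp_inj (u : 'rV[S]_(rk 0)) :
  (exists w, Q c.+1 (u *m hcomp c.+1 - w *m D c.+1)) -> exists w, u = w *m D 0.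
Proof.
suff H j : (j <= c.+1)%N -> (exists w, Q j (u *m hcomp j - w *m D j)) ->
    exists w, u = w *m D 0 by apply: H.
elim: j => [_ [w]|j IH jc ex].
  by rewrite mulmx1 => /pow_mx0E/eqP; rewrite subr_eq0 => /eqP ->; exists w.
apply: IH; first exact: ltnW.
apply: (@homotopy_step _ _ (h j j)) => //; last first.
  by case: ex => w; exists w; rewrite -mulmxA.
rewrite -!mulmxA scalemxAr -mulmxBr mulmxA; apply: pow_mx_mull.
exact: hcomp_cycle.
Qed.

Definition coef_mx p q m (A : 'M[S]_(p, q)) : 'M[K]_(p, q) := map_mx (mcoeff m) A.

Lemma coef_mxM_lowest p q r m (A : 'M[S]_(p, q)) (B : 'M[S]_(q, r)) :
  (forall a b m', (m' <= m)%MM -> m' != m -> (A a b)@_m' = 0) ->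
  coef_mx m (A *m B) = coef_mx m A *m coef_mx 0%MM B.
Proof.
move=> A0; apply/matrixP => a b; rewrite !mxE raddf_sum /=.
by apply: eq_bigr => k _; rewrite mcoeffM_lowest ?mxE //; exact: A0.
Qed.

(** For positive [N], the socle generator of S/(x_0^N, ..., x_c^N). *)
Definition top_mnm : 'X_{1..c.+1} := [multinom N.-1 | _ < c.+1].

Hypothesis N_gt0 : (0 < N)%N.

Lemma pow_mnmN m : ~~ pow_mnm N c.+1 m = (m <= top_mnm)%MM.
Proof.
apply/existsPn/mnm_lepP => H i; move: (H i); rewrite mnmE ltn_ord -ltnNge.
  by rewrite -[in X in X -> _](prednK N_gt0).
by rewrite -[in X in _ -> X](prednK N_gt0).
Qed.

Lemma mdeg_top : mdeg top_mnm = (c.+1 * N.-1)%N.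
Proof.
rewrite mdegE; under eq_bigr => i _ do rewrite mnmE.
by rewrite sum_nat_const card_ord.
Qed.

Lemma mdeg_lt (m m' : 'X_{1..c.+1}) :
  (m' <= m)%MM -> m' != m -> (mdeg m' < mdeg m)%N.
Proof.
move=> lem nem; rewrite -(submK lem) mdegD -[X in (X < _)%N]add0n ltn_add2r lt0n.
by apply: contra nem; rewrite mdeg_eq0 => /eqP mm; rewrite -(submK lem) mm add0m.
Qed.

Variable d : nat.
Local Notation T i := (coef_mx 0%MM (D i)).
Local Notation piece j :=
  (diag_mx (\row_b (gd b == j)%:R) : 'M[K]_(rk c.+1)).
Hypothesis vanish : forall j, (d + c.+1 < j)%N ->
  (kermx (T c) :&: piece j <= T c.+1)%MS.

(* The lowest-degree coefficients of u are cycles of K (x) F in a degree where its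
   homology vanishes, so a boundary cancels them; only the socle monomial of
   S/(x_0^N, ..., x_c^N) is left in the end. *)
Lemma cycle_reduce (u : 'rV[S]_(rk c.+1)) :
  homog_mx (fun _ => d + c.+1 * N)%N (@gd c.+1) 0 u ->
  Q c.+1 (u *m D c) ->
  exists w (z : 'rV[K]_(rk c.+1)), z *m T c = 0 /\
    Q c.+1 (u - w *m D c.+1 - 'X_[top_mnm] *: map_mx (@mpolyC _ _) z).
Proof.
set e := (d + _)%N.
pose low t (v : 'rV[S]_(rk c.+1)) :=
  forall b m, (m <= top_mnm)%MM -> (mdeg m < t)%N -> (v 0 b)@_m = 0.
have lowP t (v : 'rV[S]_(rk c.+1)) m : low t v -> (m <= top_mnm)%MM ->
    (mdeg m <= t)%N -> forall a b m', (m' <= m)%MM -> m' != m -> (v a b)@_m' = 0.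
  move=> lv mt mdt a b m' m'm nem; rewrite ord1; apply: lv.
    exact: lepm_trans m'm mt.
  exact: leq_trans (mdeg_lt m'm nem) mdt.
have cyc0 (v : 'rV[S]_(rk c.+1)) m : (m <= top_mnm)%MM -> Q c.+1 (v *m D c) ->
    coef_mx m (v *m D c) = 0.
  by move=> mt hv; apply/matrixP => a b; rewrite mxE hv ?pow_mnmN // mxE.
(* Induction on a lower bound [t] for the degrees of the monomials of [v] outside the ideal; [k] is
   the distance from [t] to the socle degree. *)
suff gen k t v : (k + t = c.+1 * N.-1)%N -> low t v ->
    homog_mx (fun _ => e) (@gd c.+1) 0 v -> Q c.+1 (v *m D c) ->
    exists w (z : 'rV[K]_(rk c.+1)), z *m T c = 0 /\
    Q c.+1 (v - w *m D c.+1 - 'X_[top_mnm] *: map_mx (@mpolyC _ _) z).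
  by apply: (gen (c.+1 * N.-1)%N 0) => //; rewrite addn0.
elim: k t v => [|k IH] t v kt lv hv cyc.
  move: kt; rewrite add0n => tE; exists 0, (coef_mx top_mnm v); split.
    rewrite -coef_mxM_lowest ?cyc0 ?lepm_refl //.
    by apply: (lowP t) => //; rewrite ?lepm_refl // tE mdeg_top.
  move=> a b m; rewrite ord1 pow_mnmN => mt.
  rewrite mul0mx subr0 !mxE mcoeffB mulrC mul_mpolyC mcoeffZ mcoeffX.
  have [->|nem] := eqVneq; first by rewrite mulr1 subrr.
  rewrite mulr0 subr0 lv // tE -mdeg_top; apply: mdeg_lt => //.
  by rewrite eq_sym.
pose vt : 'rV[S]_(rk c.+1) :=
  map_mx (mfilter (fun m => (m <= top_mnm)%MM && (mdeg m == t))) v.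
have vtE m : (m <= top_mnm)%MM ->
    coef_mx m vt = if mdeg m == t then coef_mx m v else 0.
  move=> mt; apply/rowP => b; rewrite !mxE mcoeff_mfilter mt /=.
  by case: ifP; rewrite !mxE.
have lvt : low t vt.
  move=> b m mt mdt; have /rowP/(_ b) := vtE m mt; rewrite !mxE => ->.
  by rewrite ltn_eqF // mxE.
(* A preimage under [T c.+1] of the lowest part, with constants as matrix entries, cancels that
   part; passing to the homogeneous part [w] of [w0] keeps the row homogeneous. *)
pose w0 := vt *m map_mx (@mpolyC c.+1 K) (pinvmx (T c.+1)).
pose w := homog_part (fun _ => e) (@gd c.+2) 0 w0.
have vE : v - w *m D c.+1 =
    homog_part (fun _ => e) (@gd c.+1) 0 (v - w0 *m D c.+1).
  apply/eqP; rewrite subr_eq -(@homog_part_mulr _ _ _ _ _ _ _ (@gd c.+1)) //.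
  by rewrite -homog_partD subrK homog_part_id.
have w0E m : (m <= top_mnm)%MM -> (mdeg m <= t)%N ->
    coef_mx m (w0 *m D c.+1) = coef_mx m vt *m pinvmx (T c.+1) *m T c.+1.
  move=> mt mdt; rewrite /w0 -[X in coef_mx _ X]mulmxA coef_mxM_lowest; last first.
    exact: (lowP _ _ _ lvt mt mdt).
  rewrite -[RHS]mulmxA; congr (_ *m _).
  apply/matrixP => a b; rewrite !mxE raddf_sum; apply: eq_bigr => i _ /=.
  by rewrite !mxE mcoeffCM.
have lv' : low t.+1 (v - w *m D c.+1).
  move=> b m mt; rewrite ltnS => mdt; rewrite vE mxE mcoeff_mfilter.
  case: ifP => // _; suff : coef_mx m (v - w0 *m D c.+1) = 0.
    by move/rowP/(_ b); rewrite [LHS]mxE [RHS]mxE.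
  rewrite /coef_mx map_mxB -/(coef_mx m _) -/(coef_mx m _) w0E // vtE //.
  have [mdE|nem] := eqVneq (mdeg m) t; last first.
    rewrite !mul0mx subr0; apply/rowP => b'; rewrite !mxE lv //.
    by rewrite ltn_neqAle nem.
  (* The coefficients of [v] at [m] form a cycle supported on generators of degree [e - t]. As [t]
     is below the socle degree, [e - t] exceeds [d + c.+1]. *)
  rewrite mulmxKpV ?subrr //; apply: submx_trans (vanish (j := e - t) _); last first.
    rewrite ltn_subRL /e -[X in (_ * X)%N](prednK N_gt0) mulnS -kt; lia.
  rewrite sub_capmx; apply/andP; split.
    by apply/sub_kermxP; rewrite -coef_mxM_lowest ?cyc0 //; exact: (lowP t v m).
  suff -> : coef_mx m v = coef_mx m v *m piece (e - t)%N by exact: submxMl.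
  apply/rowP => b'; rewrite mul_mx_diag !mxE.
  have [mv|/memN_msupp_eq0 ->] := boolP (m \in msupp (v 0 b')); last by rewrite mul0r.
  by have := hv _ _ _ mv; rewrite addn0 => <-; rewrite mdE addKn eqxx mulr1.
have [|||w1 [z [zT hz]]] := IH t.+1 _ _ lv'.
- by rewrite addnS -addSn.
- by rewrite vE; exact: homog_partP.
- by rewrite mulmxBl -mulmxA DD0 mulmx0 subr0.
exists (w + w1), z; split; first exact: zT.
have -> : v - (w + w1) *m D c.+1 = v - w *m D c.+1 - w1 *m D c.+1.
  by rewrite mulmxDl opprD addrA.
exact: hz.
Qed.
(** Modulo the powers, the socle monomial kills every polynomial with zero constant term, so only
    the constant part of [D c.+1] acts on it. *)
Lemma top_boundary (l : 'rV[K]_(rk c.+2)) :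
  Q c.+1 ('X_[top_mnm] *: map_mx (@mpolyC _ _) (l *m T c.+1) -
          ('X_[top_mnm] *: map_mx (@mpolyC _ _) l) *m D c.+1).
Proof.
rewrite -scalemxAl -scalerBr => a b m; rewrite ord1 pow_mnmN mxE mulrC => mt.
set p := (X in (X * _)@__); have p0 : p@_0%MM = 0.
  rewrite /p !mxE mcoeffB mcoeffC eqxx mulr1 raddf_sum /=; apply/eqP.
  rewrite subr_eq0; apply/eqP/eq_bigr => k _.
  by rewrite !mxE mcoeffCM.
have [->|nem] := eqVneq m top_mnm; first by rewrite -[X in _@_X]addm0 mcoeffMX.
rewrite mulrC mcoeffM_eq0 // => m' m'm; rewrite mcoeffX; case: eqP => // m'E.
case/negP: nem; apply/eqP/mnmP => i; apply/eqP; rewrite eqn_leq.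
by rewrite (mnm_lepP mt i) m'E; exact/mnm_lepP.
Qed.

Lemma boundary_sub_cycle : (T c.+1 <= kermx (T c))%MS.
Proof.
apply/sub_kermxP; rewrite -coef_mxM_lowest.
  by rewrite DD0; apply/matrixP => a b; rewrite !mxE mcoeff0.
move=> a b m' /mnm_lepP m'0 /eqP[]; apply/mnmP => i.
by apply/eqP; rewrite mnm0E -leqn0; have := m'0 i; rewrite mnm0E.
Qed.

(** [cycle_reduce] attaches to each row of [u] a cycle of K (x) F. If a combination of these cycles
    is a boundary, the same combination of rows, pushed by [hcomp], is a boundary modulo all powers,
    hence by [hcomp_inj] a boundary in F_0. So the [r] cycles are independent in homology. *)
Lemma homology_bound r (u : 'M[S]_(r, rk 0)) :
  homog_mx (fun _ => d) (@gd 0) 0 u ->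
  (forall mu : 'rV[K]_r,
    (exists w, map_mx (@mpolyC _ _) mu *m u = w *m D 0) -> mu = 0) ->
  (r + \rank (T c.+1) <= \rank (kermx (T c)))%N.
Proof.
move=> hu uD.
have cyc (a : 'I_r) : exists wz : 'rV[S]_(rk c.+2) * 'rV[K]_(rk c.+1),
    wz.2 *m T c = 0 /\ Q c.+1 (row a u *m hcomp c.+1 - wz.1 *m D c.+1 -
      'X_[top_mnm] *: map_mx (@mpolyC _ _) wz.2).
  have [||w [z wz]] := @cycle_reduce (row a u *m hcomp c.+1).
  - have hua : homog_mx (fun _ => d) (@gd 0) 0 (row a u).
      by move=> i b m; rewrite mxE => /hu.
    by move=> i b m /(homog_mx_mul hua (@homog_hcomp c.+1)) ->; rewrite addn0.
  - rewrite -mulmxA; apply: pow_mx_mull.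
    rewrite -[_ *m _](subrK (y c *: hcomp c)); apply: pow_mxD.
      by apply: pow_mxS; exact: hcomp_cycle.
    exact: pow_mx_scale.
  by exists (w, z).
have {cyc} /fin_all_exists[f fP] := cyc.
pose Z := \matrix_a (f a).2; pose W := \matrix_a (f a).1.
have ZT : (Z <= kermx (T c))%MS.
  by apply/row_subP => a; rewrite rowK; apply/sub_kermxP; case: (fP a).
have hW : Q c.+1 (u *m hcomp c.+1 - W *m D c.+1 -
      'X_[top_mnm] *: map_mx (@mpolyC _ _) Z).
  move=> a b; have := (fP a).2 0 b; set M := (X in fun_of_matrix X a b).
  suff <- : row a M = row a u *m hcomp c.+1 - (f a).1 *m D c.+1 -
      'X_[top_mnm] *: map_mx (@mpolyC _ _) (f a).2 by rewrite mxE.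
  by rewrite !raddfB /= !row_mul linearZ /= -map_row !rowK.
have Zfree : row_free (Z *m cokermx (T c.+1)).
  rewrite -kermx_eq0; apply/rowV0P => mu /sub_kermxP.
  rewrite mulmxA => /eqP; rewrite -submxE => /submxP[l lE].
  apply: uD; apply: hcomp_inj.
  exists (map_mx (@mpolyC _ _) mu *m W + 'X_[top_mnm] *: map_mx (@mpolyC _ _) l).
  have := pow_mxD (pow_mx_mull (map_mx (@mpolyC _ _) mu) hW) (@top_boundary l).
  rewrite -lE map_mxM !mulmxBr -scalemxAr !mulmxA mulmxDl opprD.
  by rewrite addrA subrK addrA.
have := mxrank_mul_ker (kermx (T c)) (cokermx (T c.+1)).
have TT : (T c.+1 <= kermx (T c) :&: kermx (cokermx (T c.+1)))%MS.
  by rewrite sub_capmx boundary_sub_cycle sub_kermx mulmx_coker eqxx.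
move=> <-; apply: leq_add (mxrankS TT).
by rewrite -(eqP Zfree); exact/mxrankS/submxMr.
Qed.

End Complex.

(** * Height and algebraic dependence *)

(** Membership is a proposition and the unit ideal is allowed, unlike in [idealr]; this covers
    unions of chains, P + (z) and the null-homotopic elements. *)
Definition is_ideal (R : comNzRingType) (C : R -> Prop) : Prop :=
  [/\ C 0, forall x y, C x -> C y -> C (x + y) & forall a x, C x -> C (a * x)].

Section AlgebraicDependence.

Variables (k : fieldType) (n q : nat).
Local Notation S := {mpoly k[n]}.
Local Notation W := {mpoly {mpoly k[n]}[q]}.
Local Notation cst := (@mpolyC q {mpoly k[n]} \o @mpolyC n k).

Definition in_ext (C : S -> Prop) (p : W) : Prop := forall m, C p@_m.

Definition lin_indep (C : S -> Prop) (T : finType) (v : T -> W) : Prop :=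
  forall x : T -> k, in_ext C (\sum_t cst (x t) * v t) -> forall t, x t = 0.

(** Exponents are bounded one variable at a time, so that bounded polynomials are spanned by a box
    of (e + 1)^(n + q) monomials. *)
Definition bounded (e : nat) (p : W) : Prop := forall m m',
  p@_m@_m' != 0 -> (forall i, m i <= e)%N /\ (forall i, m' i <= e)%N.

Lemma bounded_le e e' p : (e <= e')%N -> bounded e p -> bounded e' p.
Proof.
move=> ee' bp m m' /bp[h h']; split=> i; exact: leq_trans ee'.
Qed.

Lemma bounded_ex p : exists e, bounded e p.
Proof.
exists (msize p + \sum_(m <- msupp p) msize p@_m)%N => m m' nz.
have mdegi l (u : 'X_{1..l}) i : (u i <= mdeg u)%N by rewrite mdegE (bigD1 i) ?leq_addr.
have mp : m \in msupp p.
  by rewrite mcoeff_msupp; apply: contraNneq nz => ->; rewrite mcoeff0.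
have mp' : m' \in msupp p@_m by rewrite mcoeff_msupp.
split=> i; apply: leq_trans (mdegi _ _ _) _; apply: ltnW.
  by apply: leq_trans (msize_mdeg_lt mp) (leq_addr _ _).
rewrite (bigD1_seq m) ?msupp_uniq //= addnCA.
by apply: leq_trans (msize_mdeg_lt mp') (leq_addr _ _).
Qed.

Lemma big_neq0 (V : nmodType) (I : Type) (s : seq I) (P : pred I) (F : I -> V) :
  \sum_(i <- s | P i) F i != 0 -> exists2 i, P i & F i != 0.
Proof.
move=> nz; have [//|no] := boolp.pselect (exists2 i, P i & F i != 0).
case/eqP: nz; apply: big1 => i Pi; apply/eqP/negPn/negP => Fi.
by apply: no; exists i.
Qed.

Lemma boundedM e e' p p' :
  bounded e p -> bounded e' p' -> bounded (e + e') (p * p').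
Proof.
move=> bp bp' m m'; rewrite mcoeffM raddf_sum /= => /big_neq0[[m1 m2] /= /eqP mE].
rewrite mcoeffM => /big_neq0[[l1 l2] /= /eqP m'E].
rewrite mulf_eq0 negb_or => /andP[/bp[h1 h2] /bp'[h1' h2']].
by rewrite mE m'E; split=> i; rewrite mnmDE leq_add.
Qed.

Lemma bounded1 : bounded 0 1.
Proof.
move=> m m'; rewrite mcoeff1; have [->|_] := eqVneq m 0%MM; last by rewrite mcoeff0 eqxx.
rewrite mcoeff1; have [->|_] := eqVneq m' 0%MM; last by rewrite eqxx.
by split=> i; rewrite mnm0E.
Qed.

Lemma boundedX e p j : bounded e p -> bounded (j * e) (p ^+ j).
Proof.
move=> bp; elim: j => [|j IH]; first exact: bounded1.
by rewrite exprS mulSn; exact: boundedM.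
Qed.

Lemma bounded_prod (T : finType) (F : T -> W) e :
  (forall t, bounded e (F t)) -> bounded (#|T| * e) (\prod_t F t).
Proof.
move=> bF; rewrite -sum_nat_const.
by apply: (big_ind2 bounded); [exact: bounded1|move=> *; exact: boundedM|].
Qed.

Lemma card_lin_indep (T : finType) (v : T -> W) e :
  lin_indep (fun p => p = 0) v -> (forall t, bounded e (v t)) ->
  (#|T| <= e.+1 ^ (n + q))%N.
Proof.
move=> liv bv.
pose B : finType := ({ffun 'I_q -> 'I_e.+1} * {ffun 'I_n -> 'I_e.+1})%type.
pose mn l (f : {ffun 'I_l -> 'I_e.+1}) : 'X_{1..l} := [multinom f i : nat | i < l].
pose A : 'M[k]_(#|T|, #|B|) := \matrix_(t, b)
  (v (enum_val t))@_(mn _ (enum_val b).1)@_(mn _ (enum_val b).2).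
suff /eqP <- : row_free A.
  apply: leq_trans (rank_leq_col A) _.
  by rewrite card_prod !card_ffun !card_ord -expnD addnC.
apply: inj_row_free => x xA; apply/rowP => t; rewrite mxE.
have /(liv (fun t => x 0 (enum_rank t)))/(_ (enum_val t)) :
    in_ext (fun p => p = 0) (\sum_t cst (x 0 (enum_rank t)) * v t); last first.
  by rewrite enum_valK.
move=> m; apply/mpolyP => m'; rewrite mcoeff0 !raddf_sum /=.
under eq_bigr => s _ do rewrite mcoeffCM mcoeffCM.
have [[hm hm']|no] := boolp.pselect ((forall i, m i <= e)%N /\ (forall i, m' i <= e)%N).
  pose b : B := ([ffun i => inord (m i)], [ffun i => inord (m' i)]).
  have /rowP/(_ (enum_rank b)) := xA; rewrite !mxE => xAb.
  rewrite (reindex (@enum_val T T)) /=; last exact/onW_bij/enum_val_bij.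
  rewrite -[RHS]xAb; apply: eq_bigr => s _; rewrite enum_valK mxE enum_rankK.
  have -> : mn q b.1 = m by apply/mnmP => i; rewrite mnmE ffunE inordK ?ltnS.
  by have -> : mn n b.2 = m' by apply/mnmP => i; rewrite mnmE ffunE inordK ?ltnS.
apply: big1 => s _; have [->|/bv] := eqVneq ((v s)@_m@_m') 0; rewrite ?mulr0 //.
Qed.

(* Modulo C' only the terms without f survive, so their coefficients vanish; the
   remaining terms can then be divided by f, which is regular modulo C. *)
Lemma lin_indep_powers (C C' : prime_idealr S) (f : S) (T : finType) (v : T -> W) j :
  {subset C <= C'} -> f \in C' -> f \notin C ->
  lin_indep (fun p => p \in C') v ->
  lin_indep (fun p => p \in C) (fun et : 'I_j * T => f%:MP ^+ et.1 * v et.2).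
Proof.
move=> CC' fC' fC liv x.
(* Coefficients indexed by all natural numbers can be shifted by one in the induction on [j]. *)
suff gen (y : nat -> T -> k) :
    in_ext (fun p => p \in C)
      (\sum_(e < j) f%:MP ^+ e * \sum_t cst (y e t) * v t) ->
    forall (e : 'I_j) t, y e t = 0.
  pose y e t := if insub e is Some e' then x (e', t) else 0.
  have yE t (e : 'I_j) : y e t = x (e, t) by rewrite /y valK.
  move=> hx [e t]; rewrite -yE; apply: gen.
  move=> m; have := hx m; congr (_@_m \in C).
  under [RHS]eq_bigr => e' _ do rewrite mulr_sumr.
  rewrite pair_bigA; apply: eq_bigr => -[e' t'] _ /=.
  by rewrite yE mulrCA.
elim: j y {x} => [|j IH] y hy; first by case.
pose y0 := \sum_t cst (y 0%N t) * v t.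
pose y1 := \sum_(e < j) f%:MP ^+ e * \sum_t cst (y e.+1 t) * v t.
have yE : \sum_(e < j.+1) f%:MP ^+ e * (\sum_t cst (y e t) * v t) =
    y0 + f%:MP * y1.
  rewrite big_ord_recl expr0 mul1r; congr (_ + _); rewrite mulr_sumr.
  by apply: eq_bigr => e _; rewrite mulrA -exprS.
rewrite yE in hy.
have y00 : forall t, y 0%N t = 0.
  apply: liv => m; rewrite -[X in X@_m](addrK (f%:MP * y1)).
  rewrite mcoeffB; apply: rpredB; first exact: CC' (hy m).
  by rewrite mcoeffCM mulrC idealMr.
have {}hy : in_ext (fun p => p \in C) y1.
  move=> m; have := hy m; rewrite [y0]big1 ?add0r.
    by rewrite mcoeffCM prime_idealrM (negPf fC).
  by move=> t _; rewrite y00 !raddf0 mul0r.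
move=> e t; case: (unliftP ord0 e) => [e'|] -> //=.
exact: (IH (fun e => y e.+1)).
Qed.
(** Going down one prime multiplies the size of the family by [j], at the cost of exponents larger
    by at most [j * e]. *)
Lemma lin_indep_chain (C : nat -> prime_idealr S) (f : nat -> S) c e j :
  (forall i, (i < c)%N ->
    [/\ {subset C i <= C i.+1}, f i \in C i.+1 & f i \notin C i]) ->
  (forall i, (i < c)%N -> bounded e (f i)%:MP) ->
  forall (T : finType) (v : T -> W) e0,
    lin_indep (fun p => p \in C c) v -> (forall t, bounded e0 (v t)) ->
  exists (T' : finType) (v' : T' -> W), [/\ #|T'| = (j ^ c * #|T|)%N,
    lin_indep (fun p => p \in C 0) v' &
    forall t, bounded (e0 + c * (j * e)) (v' t)].
Proof.
elim: c => [|c IH] Cf bf T v e0 liv bv.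
  by exists T, v; split=> //; [rewrite mul1n|move=> t; rewrite addn0].
have [CC fC nfC] := Cf c (ltnSn c).
have [|||T' [v' [cT' liv' bv']]] := IH _ _ _ _ (j * e + e0)%N
    (lin_indep_powers (j := j) CC fC nfC liv).
- by move=> i ic; apply: Cf; exact: ltnW.
- by move=> i ic; apply: bf; exact: ltnW.
- move=> [l t] /=; apply: boundedM => //.
  apply: (bounded_le (e := (l * e)%N)); first by rewrite leq_mul2r ltnW ?orbT.
  by apply: boundedX; exact: bf.
exists T', v'; split=> //.
  by rewrite cT' card_prod card_ord mulnA expnSr.
by move=> t; rewrite mulSn addnCA addnA.
Qed.

Definition alg_indep (C : S -> Prop) r (a : 'I_r -> W) : Prop :=
  forall G : {mpoly k[r]}, in_ext C (mmap cst a G) -> G = 0.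

Lemma alg_indep_monomials (C : S -> Prop) r (a : 'I_r -> W) j :
  alg_indep C a ->
  lin_indep C (fun f : {ffun 'I_r -> 'I_j} => \prod_b a b ^+ f b).
Proof.
move=> ia x hx f; pose mn (f : {ffun 'I_r -> 'I_j}) := [multinom f b : nat | b < r].
have : \sum_f x f *: 'X_[mn f] = 0.
  apply: ia; congr (in_ext C _): hx; rewrite raddf_sum; apply: eq_bigr => g _.
  rewrite /= mmapZ mmapX /mmap1; congr (_ * _); apply: eq_bigr => b _.
  by rewrite mnmE.
move=> /(congr1 (mcoeff (mn f))); rewrite mcoeff0 raddf_sum /= (bigD1 f) //=.
rewrite mcoeffZ mcoeffX eqxx mulr1 big1 ?addr0 // => g gf.
rewrite mcoeffZ mcoeffX; case: eqP => [/mnmP E|]; last by rewrite mulr0.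
case/eqP: gf; apply/ffunP => b; apply: val_inj.
by have := E b; rewrite !mnmE.
Qed.

(* Along the chain of primes below P the r elements are completed to r + c ones
   that are algebraically independent over k in a ring with n + q variables;
   count the monomials in them with exponents less than j, for j large. *)
Lemma prime_alg_indep_bound (P : prime_idealr S) c r (a : 'I_r -> W) :
  prime_height_ge P c -> alg_indep (fun p => p \in P) a -> (r + c <= n + q)%N.
Proof.
move=> [C [chain CP]] ia.
have /boolp.choice[f fP] i : exists f, (i < c)%N ->
    [/\ {subset C i <= C i.+1}, f \in C i.+1 & f \notin C i].
  have [ic|ic] := ltnP i c; last by exists 0.
  by have [s [f f1 f2]] := chain i ic; exists f.
have [e [ea ef]] : exists e, (forall b, bounded e (a b)) /\
    (forall i, (i < c)%N -> bounded e (f i)%:MP).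
  have /boolp.choice[g gP] := fun b => bounded_ex (a b).
  have /boolp.choice[g' g'P] := fun i => bounded_ex (f i)%:MP.
  exists (\sum_b g b + \sum_(i < c) g' i)%N; split=> [b|i ic].
    by apply: bounded_le (gP b); rewrite (bigD1 b) //= -addnA leq_addr.
  apply: bounded_le (g'P i); rewrite (bigD1 (Ordinal ic)) //= addnCA.
  exact: leq_addr.
rewrite leqNgt; apply/negP => rc.
(* The family will have j^(r + c) members with exponents at most (r + c) j e, so it lies in a space
   of dimension at most (j E)^(n + q). If r + c > n + q, this forces j <= E^(n + q), which this [j]
   violates. *)
pose E := ((r + c) * e).+1; pose j := (E ^ (n + q)).+1.
have li0 : lin_indep (fun p => p \in C c)
    (fun m : {ffun 'I_r -> 'I_j} => \prod_b a b ^+ m b).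
  by apply: alg_indep_monomials => G hG; apply: ia => m; rewrite -CP; exact: hG.
have bd0 (m : {ffun 'I_r -> 'I_j}) : bounded (r * (j * e)) (\prod_b a b ^+ m b).
  rewrite -[X in (X * _)%N]card_ord; apply: bounded_prod => b.
  apply: (bounded_le (e := (m b * e)%N)); last exact: boundedX.
  by rewrite leq_mul2r ltnW ?orbT.
have [T [v [cT liv bv]]] := lin_indep_chain j fP ef li0 bd0.
have := card_lin_indep (v := v) _ bv.
rewrite cT card_ffun !card_ord -expnD leqNgt => /(_ _)/negP; apply.
  move=> x hx; apply: liv => m; rewrite (hx m); exact: idealr0.
rewrite -mulnDl.
have h1 : (((r + c) * (j * e)).+1 <= j * E)%N by rewrite /E mulnS; nia.
apply: (@leq_ltn_trans ((j * E) ^ (n + q))); last first.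
  apply: (@leq_trans (j ^ (n + q).+1)).
    by rewrite expnMn expnSr ltn_pmul2l // expn_gt0.
  by rewrite leq_exp2l ?ltnS ?expn_gt0 // [(c + r)%N]addnC.
by case: (n + q)%N => // l; rewrite leq_exp2r.
Qed.

(** Zorn's lemma applies because a polynomial has finitely many coefficients: a relation modulo the
    union of a chain already holds modulo one member. *)
Lemma maximal_alg_indep (I : S -> Prop) r (a : 'I_r -> W) :
  is_ideal I -> alg_indep I a ->
  exists P : S -> Prop, [/\ is_ideal P, (forall x, I x -> P x), alg_indep P a &
    forall P' : S -> Prop, is_ideal P' -> (forall x, P x -> P' x) ->
      alg_indep P' a -> forall x, P' x -> P x].
Proof.
move=> idI iI.
pose good (C : S -> Prop) := [/\ is_ideal C, (forall x, I x -> C x) & alg_indep C a].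
have gI : good I by [].
pose R (C C' : {C | good C}) := boolp.asbool (forall x, sval C x -> sval C' x).
have [|||[P [idP IP iP]] Pmax] := @classical_sets.ZL_preorder _ (exist _ I gI) R.
- by move=> C; apply/boolp.asboolP.
- by move=> C C' C'' /boolp.asboolP h /boolp.asboolP h'; apply/boolp.asboolP => x /h/h'.
- move=> A Atot; have [[C0 AC0]|noA] := boolp.pselect (exists C, A C); last first.
    by exists (exist _ I gI) => C AC; case: noA; exists C.
  pose U x := exists2 C, A C & sval C x.
  have Ucommon x y : U x -> U y -> exists C, [/\ A C, sval C x & sval C y].
    move=> [C AC Cx] [C' AC' C'y].
    have [/boolp.asboolP h|/boolp.asboolP h] := Atot _ _ AC AC'.
      by exists C'; split=> //; exact: h.
    by exists C; split=> //; exact: h.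
  have gU : good U.
    split.
    - split.
      + by exists C0 => //; case: (svalP C0) => -[].
      + move=> x y Ux /(Ucommon _ _ Ux)[C [AC Cx Cy]]; exists C => //.
        by case: (svalP C) => -[_ h _] _ _; exact: h.
      + move=> b x [C AC Cx]; exists C => //.
        by case: (svalP C) => -[_ _ h] _ _; exact: h.
    - by move=> x Ix; exists C0 => //; case: (svalP C0) => _ h _; exact: h.
    - move=> G hG.
      have [C AC CG] : exists2 C, A C & in_ext (sval C) (mmap cst a G).
        set p := mmap _ _ _ in hG *.
        suff [C AC hC] : exists2 C, A C & {in msupp p, forall m, sval C p@_m}.
          exists C => // m; have [/hC//|/memN_msupp_eq0 ->] := boolP (m \in msupp p).
          by case: (svalP C) => -[].
        elim: (msupp p) => [|m s [C AC hC]]; first by exists C0.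
        have [C' AC' C'm] := hG m.
        have [/boolp.asboolP h|/boolp.asboolP h] := Atot _ _ AC AC'.
          exists C' => // m'; rewrite inE => /predU1P[->//|/hC]; exact: h.
        by exists C => // m'; rewrite inE => /predU1P[->|/hC//]; exact: h.
      by case: (svalP C) => _ _ h; exact: h.
  exists (exist _ U gU) => C AC; apply/boolp.asboolP => x Cx.
  by exists C.
exists P; split=> // P' idP' PP' iP'.
have gP' : good P' by split=> // x /IP/PP'.
have PP'R : R (exist _ P (And3 idP IP iP)) (exist _ P' gP') by apply/boolp.asboolP.
by have /boolp.asboolP := Pmax _ PP'R.
Qed.

(** If [u] and [v] lie outside [P], maximality yields nonzero [G1] and [G2] whose values at [a] have
    coefficients in P + (u) and P + (v). With [u * v] in [P], the product [G1 * G2] is a relation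
    modulo [P], hence zero, which is absurd in a domain. *)
Lemma maximal_alg_indep_prime (P : S -> Prop) r (a : 'I_r -> W) :
  is_ideal P -> alg_indep P a ->
  (forall P' : S -> Prop, is_ideal P' -> (forall x, P x -> P' x) ->
    alg_indep P' a -> forall x, P' x -> P x) ->
  exists PP : prime_idealr S, forall x, x \in PP <-> P x.
Proof.
move=> [P0 PD PM] iP Pmax.
pose b x := boolp.asbool (P x).
have bE x : x \in b <-> P x by split=> /boolp.asboolP.
have adj z : ~ P z -> exists G, G <> 0 /\
    forall m, exists u, P ((mmap cst a G)@_m - u * z).
  move=> nPz; apply: boolp.contrapT => no; apply: nPz.
  apply: (Pmax (fun x => exists u, P (x - u * z))).
  - split; first by exists 0; rewrite mul0r subr0.
      move=> x y [u Pu] [v Pv]; exists (u + v); rewrite mulrDl opprD addrACA.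
      exact: PD.
    by move=> c x [u Pu]; exists (c * u); rewrite -mulrA -mulrBr; exact: PM.
  - by move=> x Px; exists 0; rewrite mul0r subr0.
  - move=> G hG; apply: boolp.contrapT => G0; apply: no; exists G; split=> // m.
  - by exists 1; rewrite mul1r subrr.
have prime : prime_idealr_closed b.
  move=> u v /bE Puv; have [//|nu] := boolP (u \in b).
  have [//|nv] := boolP (v \in b); exfalso.
  have [|G1 [G10 hG1]] := adj u; first by move=> /bE; exact/negP.
  have [|G2 [G20 hG2]] := adj v; first by move=> /bE; exact/negP.
  have /eqP : G1 * G2 = 0.
    apply: iP => m; rewrite rmorphM mcoeffM.
    elim/big_rec: _ => // -[m1 m2] x _ Px; apply: (PD) => //=.
    have [w1 h1] := hG1 m1; have [w2 h2] := hG2 m2.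
    have mulE (A : comNzRingType) (x1 x2 y1 y2 u1 u2 : A) : x1 * x2 =
        x2 * (x1 - y1 * u1) + y1 * u1 * (x2 - y2 * u2) + y1 * y2 * (u1 * u2).
      by ring.
    rewrite (mulE _ _ _ w1 w2 u v).
    by apply: (PD); first apply: (PD); exact: PM.
  by rewrite mulf_eq0 => /orP[] /eqP.
have idb : idealr_closed b.
  split; first exact/bE.
    apply/negP => /bE P1; have := oner_neq0 {mpoly k[r]}.
    rewrite (iP 1) ?eqxx // => m; rewrite -[X in P X]mulr1; exact: PM.
  by move=> c x y /bE Px /bE Py; apply/bE; apply: PD => //; exact: PM.
pose PP : prime_idealr S := HB.pack b (isIdealr.Build S b idb)
  (isPrimeIdealrClosed.Build S b prime).
by exists PP.
Qed.

(** Were [a] independent modulo [I], an ideal maximal among those containing [I] with [a] still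
    independent would be prime, and [prime_alg_indep_bound] would give r + c <= n + q. *)
Theorem alg_dependence (I : idealr S) c r (a : 'I_r -> W) :
  (forall P : prime_idealr S, {subset I <= P} -> prime_height_ge P c) ->
  (n + q < r + c)%N ->
  exists G : {mpoly k[r]}, G != 0 /\ forall m, (mmap cst a G)@_m \in I.
Proof.
move=> htI rc; apply: boolp.contrapT => no.
have idI : is_ideal (fun x => x \in I).
  split=> [|x y|x y]; [exact: idealr0|exact: rpredD|exact: idealMr].
have iI : alg_indep (fun x => x \in I) a.
  move=> G hG; apply: boolp.contrapT => /eqP G0; apply: no; exists G; split=> //.
have [P [idP IP iP Pmax]] := maximal_alg_indep idI iI.
have [PP PPE] := maximal_alg_indep_prime idP iP Pmax.
have htP : prime_height_ge PP c by apply: htI => x /IP/PPE.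
have iPP : alg_indep (fun x => x \in PP) a.
  by move=> G hG; apply: iP => m; apply/PPE.
by have := prime_alg_indep_bound htP iPP; rewrite leqNgt rc.
Qed.

End AlgebraicDependence.

(** * Generic linear sections *)

Lemma rmorph_mmap (n : nat) (R A B : comNzRingType) (f : {rmorphism R -> A})
    (h : 'I_n -> A) (g : {rmorphism A -> B}) (p : {mpoly R[n]}) :
  g (mmap f h p) = mmap (g \o f) (g \o h) p.
Proof.
rewrite /mmap rmorph_sum; apply: eq_bigr => m _.
rewrite rmorphM /mmap1 rmorph_prod /=; congr (g _ * _).
by apply: eq_bigr => i _; rewrite rmorphXn.
Qed.

Section Specialization.

Variables (k K : fieldType) (n c : nat) (io : {rmorphism k -> K}).
Variable t : 'I_n -> 'I_c -> K.
Local Notation S := {mpoly k[n]}.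
Local Notation R := {mpoly K[c]}.

Definition lin_form j : R := \sum_i t j i *: 'X_i.

Definition spec : S -> R := mmap (@mpolyC c K \o io) lin_form.

HB.instance Definition _ := GRing.RMorphism.copy spec
  (mmap (@mpolyC c K \o io) lin_form).

Lemma specC x : spec x%:MP = (io x)%:MP.
Proof. by rewrite /spec mmapC. Qed.

Lemma specXU j : spec 'X_j = lin_form j.
Proof. by rewrite /spec mmapX mmap1U. Qed.

Lemma specE p : spec p = \sum_(m <- msupp p) io p@_m *: spec 'X_[m].
Proof.
rewrite [in LHS](mpolyE p) rmorph_sum; apply: eq_bigr => m _.
by rewrite -mul_mpolyC rmorphM [X in X * _]specC mul_mpolyC.
Qed.

Lemma lin_form_homog j : lin_form j \is 1.-homog.
Proof. by apply: rpred_sum => i _; apply: dhomogZ; rewrite dhomogX /= mdeg1. Qed.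

Lemma specX_homog m : spec 'X_[m] \is (mdeg m).-homog.
Proof.
rewrite /spec mmapX /mmap1 mdegE.
apply: (big_ind2 (fun p d => p \is d.-homog)) => [|p d p' d' hp hp'|j _].
- exact: dhomog1.
- exact: dhomogM.
- by have := dhomogMn (m j) (lin_form_homog j); rewrite mul1n.
Qed.

Lemma msupp_spec p m : m \in msupp (spec p) ->
  exists2 m', m' \in msupp p & mdeg m' = mdeg m.
Proof.
rewrite mcoeff_msupp specE raddf_sum /= big_seq => /big_neq0[m' m'p nz].
exists m' => //; apply/esym/(dhomogP _ _ _ (specX_homog m')).
by rewrite mcoeff_msupp; apply: contraNneq nz => z; rewrite mcoeffZ z mulr0.
Qed.

(** Linear forms have no constant term; hence specialisation changes k (x) F only by the field
    extension [io]. *)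
Lemma mcoeff0_spec p : (spec p)@_0%MM = io p@_0%MM.
Proof.
rewrite -[in LHS](subrK (p@_0%MM)%:MP p) rmorphD mcoeffD [X in _ + X@__]specC.
rewrite mcoeffC eqxx mulr1; set p' := p - _.
have p0 : p'@_0%MM = 0 by rewrite mcoeffB mcoeffC eqxx mulr1 subrr.
rewrite memN_msupp_eq0 ?add0r //; apply/negP => /msupp_spec[m' m'p].
by move/eqP; rewrite mdeg0 mdeg_eq0 => /eqP m'0; rewrite mcoeff_msupp m'0 p0 eqxx in m'p.
Qed.

Lemma homog_mx_spec p q (ga : 'I_p -> nat) (gb : 'I_q -> nat) s (A : 'M[S]_(p, q)) :
  homog_mx ga gb s A -> homog_mx ga gb s (map_mx spec A).
Proof. by move=> hA a b m; rewrite mxE => /msupp_spec[m' /hA <- ->]. Qed.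

Variable I : idealr S.

(* The ideal generated by the image of I, as an intersection: every property of
   elements that defines an ideal can be checked on the image of I alone. *)
Definition spec_ideal (p : R) : Prop := forall J : R -> Prop,
  is_ideal J -> (forall g, g \in I -> J (spec g)) -> J p.

Lemma spec_ideal_is_ideal : is_ideal spec_ideal.
Proof.
split=> [J [J0 _ _] _ //|x y hx hy J iJ hJ|a x hx J iJ hJ].
  by case: (iJ) => _ JD _; apply: JD; [exact: hx|exact: hy].
by case: (iJ) => _ _; apply; exact: hx.
Qed.

Lemma spec_ideal_spec g : g \in I -> spec_ideal (spec g).
Proof. by move=> gI J _; apply. Qed.

Hypothesis homI : homogeneous_ideal I.

Local Notation part e := (mfilter (fun m => mdeg m == e)).

Lemma part_spec e g : part e (spec g) = spec (pihomog mdeg e g).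
Proof.
have -> : pihomog mdeg e g = part e g by [].
rewrite specE mfilter_sum {2}/mfilter rmorph_sum [RHS]big_mkcond.
apply: eq_bigr => m _; rewrite -[_ *: 'X_[m]]mul_mpolyC rmorphM [X in X * _]specC.
rewrite mul_mpolyC; set p := _ *: _; have hp : p \is (mdeg m).-homog.
  exact/dhomogZ/specX_homog.
case: eqP => [<-|ne]; first by apply: mfilter_id => m' /(dhomogP _ _ _ hp)/eqP.
apply/mpolyP => m'; rewrite mcoeff_mfilter mcoeff0; case: eqP => // m'e.
apply: memN_msupp_eq0; apply/negP => /(dhomogP _ _ _ hp) /= m'm.
by rewrite -m'm m'e in ne.
Qed.

Lemma spec_ideal_part e p : spec_ideal p -> spec_ideal (part e p).
Proof.
have [i0 iD iM] := spec_ideal_is_ideal.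
(* Only the property for all [e] at once defines an ideal, as multiplying by a monomial shifts
   degrees. *)
move=> hp; move: e; apply: (hp (fun p => forall e, spec_ideal (part e p))); last first.
  by move=> g gI e; rewrite part_spec; apply: spec_ideal_spec; exact: homI.
split=> [e|x y hx hy e|a x hx e]; first by rewrite mfilter0.
  by rewrite mfilterD; exact: iD.
rewrite (mpolyE a) mulr_suml mfilter_sum.
elim/big_rec: _ => // m y _ hy; apply: (iD) hy; rewrite mulrC.
have suppX m2 : m2 \in msupp (a@_m *: 'X_[m]) -> m2 = m.
  by move=> /msuppZ_le; rewrite msuppX inE => /eqP.
have [lem|gtm] := leqP (mdeg m) e.
  rewrite (mfilterMr (P' := fun m' => mdeg m' == (e - mdeg m)%N)).
    by rewrite mulrC; exact: iM.
  by move=> m2 /suppX -> m1; rewrite mdegD -[in LHS](subnK lem) eqn_add2r.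
rewrite (mfilterMr (P' := pred0)).
  rewrite mulrC; apply: iM; suff -> : mfilter pred0 x = 0 by [].
  by apply/mpolyP => m'; rewrite mcoeff_mfilter mcoeff0.
move=> m2 /suppX -> m1; rewrite mdegD; apply: gtn_eqF.
exact: leq_trans gtm (leq_addl _ _).
Qed.

End Specialization.

Section GenericSection.

Variables (k K : fieldType) (n c : nat) (io : {rmorphism k -> K}).
Variable t : 'I_n -> 'I_c.+1 -> K.
Variables (I : idealr {mpoly k[n]}) (c_le : forall P : prime_idealr {mpoly k[n]},
  {subset I <= P} -> prime_height_ge P c.+1).
Hypothesis homI : homogeneous_ideal I.
Variables (s : nat) (pt : 'I_s -> 'I_n * 'I_c.+1).
Hypothesis t_indep : forall G : {mpoly k[s]},
  mmap io (fun b => t (pt b).1 (pt b).2) G = 0 -> G = 0.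
(** For an index i0 fixed below, the label [inl (j, i')] stands for t_ji with i = [lift i0 i'], and
    [inr i] for z_i. *)
Variables (q : nat) (vi : 'I_n * 'I_c + 'I_c.+1 -> 'I_q).
Variable vo : 'I_q -> 'I_n * 'I_c + 'I_c.+1.
Hypothesis viK : cancel vi vo.
Hypothesis qs : (n + q < s.+1 + c.+1)%N.

Local Notation R := {mpoly K[c.+1]}.
Local Notation S := {mpoly k[n]}.
Local Notation W := {mpoly {mpoly k[n]}[q]}.
Local Notation var w := ('X_(vi w) : W).
Local Notation opt b := (omap pt (unlift ord0 b)).

Variable i0 : 'I_c.+1.

(* Over the incidence relation x_j = \sum_i t_ji z_i these elements specialise
   to z_i0, t_ji for i <> i0 and t_ji0 z_i0. *)
Definition incidence (b : option ('I_n * 'I_c.+1)) : W :=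
  match b with
  | None => var (inr i0)
  | Some (j, i) =>
    if unlift i0 i is Some i' then var (inl (j, i'))
    else ('X_j)%:MP - \sum_(i' < c) var (inl (j, i')) * var (inr (lift i0 i'))
  end.

Definition var_spec (w : 'I_n * 'I_c + 'I_c.+1) : R :=
  match w with inl (j, i') => (t j (lift i0 i'))%:MP | inr i => 'X_i end.

Definition incidence_spec : W -> R := mmap (spec io t) (var_spec \o vo).

HB.instance Definition _ := GRing.RMorphism.copy incidence_spec
  (mmap (spec io t) (var_spec \o vo)).

Definition weight (b : option ('I_n * 'I_c.+1)) : nat :=
  if b is Some (j, i) then i == i0 else 1.

Definition param (b : option ('I_n * 'I_c.+1)) : K :=
  if b is Some (j, i) then t j i else 1.

Lemma incidence_specX w : incidence_spec (var w) = var_spec w.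
Proof. by rewrite /incidence_spec mmapX mmap1U /= viK. Qed.

Lemma incidence_specC p : incidence_spec p%:MP = spec io t p.
Proof. by rewrite /incidence_spec mmapC. Qed.

Lemma incidence_specE b :
  incidence_spec (incidence b) = (param b)%:MP * 'X_i0 ^+ weight b.
Proof.
case: b => [[j i]|] /=; last by rewrite incidence_specX mul1r.
case: unliftP => [i' ->|->].
  by rewrite incidence_specX eq_sym (negPf (neq_lift _ _)) expr0 mulr1.
rewrite rmorphB rmorph_sum /= [X in X - _]incidence_specC specXU /lin_form.
rewrite (bigD1_ord i0) //= -[RHS]addr0 -addrA eqxx expr1 mul_mpolyC; congr (_ + _).
apply/eqP; rewrite subr_eq0; apply/eqP/eq_bigr => i' _.
by rewrite rmorphM /= !incidence_specX mul_mpolyC.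
Qed.

Lemma incidence_spec_ideal (p : W) :
  (forall m, p@_m \in I) -> spec_ideal io t I (incidence_spec p).
Proof.
have [i0' iD iM] := spec_ideal_is_ideal io t I.
move=> pI; rewrite /incidence_spec /mmap; elim/big_rec: _ => // m x _ hx.
by apply: (iD) hx; rewrite mulrC; apply: iM; apply: spec_ideal_spec; exact: pI.
Qed.

(* The relation among the incidence elements specialises to a nonzero univariate
   polynomial in z_i0; keep one of its homogeneous components. *)
Lemma spec_ideal_pow : exists N, spec_ideal io t I ('X_i0 ^+ N).
Proof.
have [G [G0 hG]] := alg_dependence (fun b : 'I_s.+1 => incidence (opt b)) c_le qs.
pose wt (m : 'X_{1..s.+1}) := (\sum_b weight (opt b) * m b)%N.
have := incidence_spec_ideal hG; rewrite [incidence_spec _]rmorph_mmap.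
set Y := mmap _ _ _.
have YE : Y = \sum_(m <- msupp G)
    (io G@_m * \prod_b param (opt b) ^+ m b) *: 'X_i0 ^+ wt m.
  rewrite /Y /mmap; apply: eq_bigr => m _.
  rewrite /= [X in X * _]incidence_specC specC -mul_mpolyC mpolyCM -mulrA.
  congr (_ * _); rewrite rmorph_prod /wt expr_sum -big_split.
  apply: eq_bigr => b _ /=.
  by rewrite incidence_specE exprMn rmorphXn exprM.
(* The leading monomial serves to pick a weight that occurs in [G]. *)
pose m0 := mlead G; have m0G : m0 \in msupp G by exact: mlead_supp.
pose e := wt m0.
move=> /(spec_ideal_part homI e).
set u := \sum_(m <- msupp G | wt m == e) io G@_m * \prod_b param (opt b) ^+ m b.
have -> : mfilter (fun m => mdeg m == e) Y = u%:MP * 'X_i0 ^+ e.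
  rewrite YE mfilter_sum mul_mpolyC /u scaler_suml [RHS]big_mkcond.
  apply: eq_bigr => m _; apply/mpolyP => m'.
  rewrite mcoeff_mfilter !mpolyXn mcoeffZ mcoeffX.
  have [<-|ne] := eqVneq (U_(i0) *+ wt m)%MM m'.
    rewrite mdegMn mdeg1 mul1n; case: eqP => [->|_]; last by rewrite mcoeff0.
    by rewrite mcoeffZ mcoeffX eqxx.
  rewrite mulr0 if_same; case: eqP => [wtE|_]; last by rewrite mcoeff0.
  by rewrite mcoeffZ mcoeffX -wtE (negPf ne) mulr0.
move=> hu; exists e.
(* [rho] drops the exponent of the element specialising to z_i0; among monomials of equal weight
   that exponent is determined by the others. *)
pose rho (m : 'X_{1..s.+1}) := [multinom m (lift ord0 b) | b < s].
have wtE m : wt m = (m ord0 + \sum_b weight (Some (pt b)) * rho m b)%N.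
  rewrite /wt big_ord_recl unlift_none mul1n; congr (_ + _)%N.
  by apply: eq_bigr => b _; rewrite liftK mnmE.
have u0 : u != 0.
  (* [u] is the value of [G'] at the independent parameters t_ji, so it is nonzero once [G'] is,
     which shows in the coefficient at [rho m0]. *)
  pose G' := \sum_(m <- msupp G | wt m == e) G@_m *: 'X_[rho m].
  have uE : u = mmap io (fun b => t (pt b).1 (pt b).2) G'.
    rewrite raddf_sum /=; apply: eq_bigr => m _; rewrite mmapZ mmapX /mmap1.
    congr (_ * _); rewrite big_ord_recl unlift_none expr1n mul1r.
    by apply: eq_bigr => b _; rewrite liftK mnmE /=; case: (pt b).
  apply/eqP => u0; have /t_indep := etrans (esym uE) u0.
  move=> /(congr1 (mcoeff (rho m0))); rewrite mcoeff0 raddf_sum /=.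
  rewrite -big_filter (bigD1_seq m0) ?filter_uniq ?msupp_uniq //=; last first.
    by rewrite mem_filter eqxx.
  rewrite mcoeffZ mcoeffX eqxx mulr1 big_filter_cond big1 ?addr0 => [/eqP|m].
    by rewrite mcoeff_eq0 m0G.
  move=> /andP[/eqP we nem]; rewrite mcoeffZ mcoeffX; case: eqP => [rE|_]; last first.
    by rewrite mulr0.
  case/eqP: nem; apply/mnmP => b; case: (unliftP ord0 b) => [b'|] ->.
    by have /mnmP/(_ b') := rE; rewrite !mnmE.
  by move: we; rewrite /e !wtE rE => /addIn.
have [_ _ iM] := spec_ideal_is_ideal io t I.
by have := iM (u^-1)%:MP _ hu; rewrite mulrA -mpolyCM mulVf // mul1r.
Qed.

End GenericSection.

Lemma generic_point (k : fieldType) s :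
  exists (K : fieldType) (io : {rmorphism k -> K}) (tau : 'I_s -> K),
    forall G : {mpoly k[s]}, mmap io tau G = 0 -> G = 0.
Proof.
pose tf : {rmorphism {mpoly k[s]} -> {fraction {mpoly k[s]}}} :=
  @FracField.tofrac {mpoly k[s]}.
exists {fraction {mpoly k[s]}}, (tf \o @mpolyC s k), (fun b => tf 'X_b) => G.
have <- : tf (mmap (@mpolyC s k) (fun b => 'X_b) G) =
    mmap (tf \o @mpolyC s k) (fun b => tf 'X_b) G by rewrite rmorph_mmap.
move/eqP; rewrite tofrac_eq0 => /eqP <-.
rewrite [LHS]mpolyE; apply: eq_bigr => m _.
by rewrite mmap1_id mul_mpolyC.
Qed.

Lemma generic_section (k : fieldType) n c (I : idealr {mpoly k[n]}) :
  (forall P : prime_idealr {mpoly k[n]}, {subset I <= P} -> prime_height_ge P c.+1) ->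
  homogeneous_ideal I ->
  exists (K : fieldType) (io : {rmorphism k -> K}) (t : 'I_n -> 'I_c.+1 -> K) N,
    (0 < N)%N /\ forall i, spec_ideal io t I ('X_i ^+ N).
Proof.
move=> htI homI.
have [K [io [tau indep]]] := generic_point k #|{: 'I_n * 'I_c.+1}|.
pose t j i := tau (enum_rank (j, i)).
have t_indep (G : {mpoly k[#|{: 'I_n * 'I_c.+1}|]}) :
    mmap io (fun b => t (enum_val b).1 (enum_val b).2) G = 0 -> G = 0.
  move=> hG; apply: indep; rewrite -hG; apply: eq_bigr => m _; congr (_ * _).
  by apply: mmap1_eq => b; rewrite /t -surjective_pairing enum_valK.
(* The n + n c + c + 1 variables fall short by exactly one of the n (c + 1) + 1 incidence elements
   plus the height bound c + 1. *)
have cardq : (n + #|{: 'I_n * 'I_c + 'I_c.+1}| < #|{: 'I_n * 'I_c.+1}|.+1 + c.+1)%N.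
  by rewrite card_sum !card_prod !card_ord; nia.
have [N hN] := fin_all_exists (spec_ideal_pow htI homI t_indep (@enum_rankK _) cardq).
exists K, io, t, (\sum_i N i).+1; split=> // i.
have [_ _ iM] := spec_ideal_is_ideal io t I.
by rewrite (bigD1 i) //= -addnS addnC exprD; apply: iM.
Qed.

(** * Elements of I act null-homotopically *)

Section NullHomotopy.

Variables (R : comNzRingType) (rk : nat -> nat).
Variable D : forall i, 'M[R]_(rk i.+1, rk i).

Definition null_homotopic (y : R) : Prop :=
  exists h : forall i, 'M[R]_(rk i, rk i.+1), h 0 *m D 0 = y%:M /\
    forall i, h i.+1 *m D i.+1 + D i *m h i = y%:M.

(** As [spec_ideal] is an intersection of ideals, this reduces null-homotopy on all of it to the
    images of elements of [I]. *)
Lemma null_homotopic_is_ideal : is_ideal null_homotopic.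
Proof.
split=> [|x y [h [h0 hS]] [h' [h'0 h'S]]|a x [h [h0 hS]]].
- by exists (fun=> 0); split=> [|i]; rewrite !(mul0mx, mulmx0) ?addr0 raddf0.
- exists (fun i => h i + h' i); rewrite [(x + y)%:M]raddfD /= -h0 -h'0 mulmxDl.
  split=> // i.
  by rewrite mulmxDl mulmxDr addrACA hS h'S -raddfD.
- exists (fun i => a *: h i); rewrite -scale_scalar_mx -h0 -scalemxAl; split=> // i.
  by rewrite -scalemxAl -scalemxAr -scalerDr hS scale_scalar_mx.
Qed.

Lemma mulmx_rows_ex p q r (A : 'M[R]_(p, r)) (B : 'M[R]_(q, r)) :
  (forall a, exists w, row a A = w *m B) -> exists X, A = X *m B.
Proof.
move=> /fin_all_exists[f fP]; exists (\matrix_a f a).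
by apply/row_matrixP => a; rewrite row_mul rowK fP.
Qed.

Lemma null_homotopic_exact (y : R) :
  (forall i, D i.+1 *m D i = 0) ->
  (forall i (v : 'rV_(rk i.+1)), v *m D i = 0 -> exists w, v = w *m D i.+1) ->
  (exists h0, h0 *m D 0 = y%:M) -> null_homotopic y.
Proof.
move=> DD0 ex [h0 h0P].
(* Each map carries the proof that [y%:M - D i *m h] lands in the cycles; exactness then factors it
   through [D i.+1], which gives the next map. *)
pose good i := {h : 'M[R]_(rk i, rk i.+1) | (y%:M - D i *m h) *m D i = 0}.
have next i (h : good i) : {h' : good i.+1 | sval h' *m D i.+1 + D i *m sval h = y%:M}.
  apply: boolp.cid; case: h => h hP /=.
  have [h' h'P] : exists h', y%:M - D i *m h = h' *m D i.+1.
    apply: mulmx_rows_ex => a; apply: ex; rewrite -row_mul hP.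
    by apply/rowP => b; rewrite !mxE.
  have gh' : (y%:M - D i.+1 *m h') *m D i.+1 = 0.
    rewrite mulmxBl -mulmxA -h'P mulmxBr mulmxA DD0 mul0mx subr0.
    by rewrite mul_scalar_mx mul_mx_scalar subrr.
  by exists (exist _ h' gh'); rewrite /= -h'P subrK.
have g0 : (y%:M - D 0 *m h0) *m D 0 = 0.
  by rewrite mulmxBl -mulmxA h0P mul_scalar_mx mul_mx_scalar subrr.
pose h := fix h i : good i :=
  match i with 0 => exist _ h0 g0 | i'.+1 => sval (next i' (h i')) end.
exists (fun i => sval (h i)); split=> // i.
exact: (svalP (next i (h i))).
Qed.

End NullHomotopy.

Lemma null_homotopic_map (R R' : comNzRingType) (f : {rmorphism R -> R'})
    (rk : nat -> nat) (D : forall i, 'M[R]_(rk i.+1, rk i)) y :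
  null_homotopic D y -> null_homotopic (fun i => map_mx f (D i)) (f y).
Proof.
move=> [h [h0 hS]]; exists (fun i => map_mx f (h i)); split=> [|i].
  by rewrite -map_mxM h0 map_scalar_mx.
by rewrite -!map_mxM -map_mxD hS map_scalar_mx.
Qed.

(** * Degree bounds, monomials and the given resolution *)

Section LowDegree.

Variables (R : comNzRingType) (n d : nat).

(** The [d]-th power of the ideal of the variables. *)
Definition low_zero (p : {mpoly R[n]}) : Prop :=
  forall m, (mdeg m < d)%N -> p@_m = 0.

Lemma low_zero_is_ideal : is_ideal low_zero.
Proof.
split=> [m _|p q hp hq m md|a p hp m md]; first by rewrite mcoeff0.
  by rewrite mcoeffD hp // hq // addr0.
rewrite mulrC mcoeffM_eq0 // => m' m'm; apply: hp.
apply: leq_ltn_trans md; rewrite -(submK m'm) mdegD; exact: leq_addl.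
Qed.

End LowDegree.

Lemma monomials_of_degree c d :
  exists mon : 'I_('C(c + d, c)) -> 'X_{1..c.+1},
    injective mon /\ forall a, mdeg (mon a) = d.
Proof.
move: (card_ord_partitions c d); set A := [set _ | _] => <-.
exists (fun a : 'I_#|A| => [multinom (tnth (enum_val a) i : nat) | i < c.+1]).
split=> [a b /mnmP E|a].
  apply/enum_val_inj/eq_from_tnth => i; apply: val_inj.
  by have := E i; rewrite !mnmE.
have := enum_valP a; rewrite inE => /eqP sumE; rewrite mdegE -[RHS]sumE big_tuple.
by apply: eq_bigr => i _; rewrite mnmE.
Qed.

Section Resolution.

Variables (k : fieldType) (n : nat) (I : idealr {mpoly k[n]}) (F : free_seq k n).
Hypothesis resF : graded_free_resolution I F.
Local Notation S := {mpoly k[n]}.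

Lemma res_homog i : homog_mx (@gdeg _ _ F i.+1) (@gdeg _ _ F i) 0 (dif F i).
Proof. by case: resF => h _ _ _ _ a b m /h; rewrite addn0. Qed.

Lemma res_aug_homog : homog_mx (@gdeg _ _ F 0) (fun _ => 0%N) 0 (aug F).
Proof.
case: resF => _ h _ _ _ a b m; rewrite ord1 => /(dhomogP _ _ _ (h a)) /= ->.
by rewrite !addn0.
Qed.

Lemma res_dif2 i : dif F i.+1 *m dif F i = 0.
Proof.
case: resF => _ _ _ _ h; apply/row_matrixP => a; rewrite row_mul row0.
by apply/h; exists (delta_mx 0 a); rewrite -rowE.
Qed.

Lemma res_aug_dif a : (dif F 0 *m aug F) a 0 \in I.
Proof.
case: resF => _ _ _ h _; have := (h (row a (dif F 0))).2; rewrite -row_mul mxE.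
by apply; exists (delta_mx 0 a); rewrite -rowE.
Qed.

(** Multiplication by [g] is zero on S/I, so it sends F_0 into the image of F_1, and exactness
    supplies the higher maps. *)
Lemma res_null_homotopic g : g \in I -> null_homotopic (dif F) g.
Proof.
move=> gI; have [_ _ _ h0 hS] := resF.
apply: null_homotopic_exact; [exact: res_dif2|by move=> i v /hS|].
have [|X XE] := @mulmx_rows_ex _ _ _ _ (g%:M : 'M_(rk F 0)) (dif F 0); last by exists X.
move=> a; apply/h0; rewrite -row_mul mul_scalar_mx !mxE mulrC.
exact: idealMr.
Qed.

Lemma tor_vanish i j : tor_dim F i.+1 j = 0%N ->
  (kermx (tdif F i) :&: tpiece F i.+1 j <= tdif F i.+1)%MS.
Proof.
rewrite /tor_dim /= => /eqP; rewrite mxrank_eq0 => /eqP z.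
set A := (_ :&: _)%MS in z *; set B := (_ :&: _)%MS in z *.
rewrite -(addsmx_diff_cap_eq A B) z adds0mx_id.
by apply: submx_trans (capmxSr _ _) (capmxSl _ _).
Qed.

Lemma rank_le_betti i r :
  (r + \rank (tdif F i.+1) <= \rank (kermx (tdif F i)) -> r <= betti F i.+1)%N.
Proof.
rewrite /betti /= -(mxrank_cap_compl (kermx (tdif F i)) (tdif F i.+1)) addnC.
move=> h; rewrite -(leq_add2l (\rank (tdif F i.+1))); apply: leq_trans h _.
by rewrite leq_add2r mxrankS // capmxSr.
Qed.

End Resolution.

(* Beyond the height only two consequences of N_{d,c} matter: I starts in degree
   d and Tor_c lives in degrees at most d + c - 1. *)
Lemma binomial_le_betti (k : fieldType) (n : nat) (I : idealr {mpoly k[n]})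
    (c d : nat) (F : free_seq k n) :
  homogeneous_ideal I -> (0 < d)%N ->
  (forall P : prime_idealr {mpoly k[n]}, {subset I <= P} -> prime_height_ge P c.+1) ->
  graded_free_resolution I F -> generated_in_degree I d ->
  (forall j, (d + c < j)%N -> tor_dim F c.+1 j = 0%N) ->
  ('C(c + d.-1, c) <= betti F c.+1)%N.
Proof.
move=> homI d_gt0 htI resF genI tor0I.
have [K [io [t [N [N_gt0 powI]]]]] := generic_section htI homI.
pose phi : {rmorphism {mpoly k[n]} -> {mpoly K[c.+1]}} := spec io t.
pose D i := map_mx phi (dif F i).
have homogD i : homog_mx (@gdeg _ _ F i.+1) (@gdeg _ _ F i) 0 (D i).
  by apply: homog_mx_spec; exact: (res_homog resF).
have DD0 i : D i.+1 *m D i = 0 by rewrite /D -map_mxM (res_dif2 resF) map_mx0.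
have nullI p : spec_ideal io t I p -> null_homotopic D p.
  apply; first exact: null_homotopic_is_ideal.
  move=> g gI; exact/(@null_homotopic_map _ _ phi)/(res_null_homotopic resF).
have lowI p : spec_ideal io t I p -> low_zero d p.
  apply; first exact: low_zero_is_ideal.
  move=> g gI m md; apply: memN_msupp_eq0; apply/negP => /msupp_spec[m' m'g mE].
  suff : low_zero d g.
    by move=> /(_ m'); rewrite mE => /(_ md)/eqP; rewrite mcoeff_eq0 m'g.
  have [l [gg [a [ggP ->]]]] := genI g gI; have [i0 iD iM] := low_zero_is_ideal k n d.
  elim/big_rec: _ => // i x _ hx; apply: (iD) hx; apply: iM => m1 m1d.
  apply: memN_msupp_eq0; apply/negP => /(dhomogP _ _ _ (ggP i).2) /= m1E.
  by rewrite m1E ltnn in m1d.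
have /boolp.choice[h0 h0P] j := nullI _ (powI (inord j)).
(* The homotopies [h0] need not be homogeneous; their parts of degree [N] satisfy the same
   identities, as [D] has degree 0 and x_j^N has degree [N]. *)
pose h j i := homog_part (@gdeg _ _ F i) (@gdeg _ _ F i.+1) N (h0 j i).
have homogy p (j : 'I_c.+1) (ga : 'I_p -> nat) :
    homog_mx ga ga N (('X_j ^+ N : {mpoly K[c.+1]})%:M).
  apply: homog_scalar_mx; rewrite mpolyXn dhomogX /= mdegMn mdeg1 mul1n.
  exact: eqxx.
have hh0 j : (j <= c)%N -> h j 0 *m D 0 = ('X_(inord j) ^+ N)%:M.
  move=> _; rewrite -(homog_part_id (homogy _ (inord j) (@gdeg _ _ F 0))).
  by rewrite -(h0P j).1 (@homog_part_mulr _ _ _ _ _ _ (@gdeg _ _ F 1)).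
have hhS j i : (j <= c)%N -> h j i.+1 *m D i.+1 + D i *m h j i = ('X_(inord j) ^+ N)%:M.
  move=> _; rewrite -(homog_part_id (homogy _ (inord j) (@gdeg _ _ F i.+1))).
  rewrite -((h0P j).2 i) homog_partD.
  rewrite (@homog_part_mulr _ _ _ _ _ _ (@gdeg _ _ F i.+2)) //.
  by rewrite (@homog_part_mull _ _ _ _ _ _ (@gdeg _ _ F i)).
have TE i : coef_mx 0%MM (D i) = map_mx io (tdif F i).
  by apply/matrixP => a b; rewrite !mxE mcoeff0_spec.
pose piece j : 'M[K]_(rk F c.+1) := diag_mx (\row_b (gdeg (f := F) b == j)%:R).
have vanish j : (d.-1 + c.+1 < j)%N ->
    (kermx (coef_mx 0%MM (D c)) :&: piece j <= coef_mx 0%MM (D c.+1))%MS.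
  move=> jd; have tor0 : tor_dim F c.+1 j = 0%N by apply: tor0I; lia.
  have := tor_vanish tor0; rewrite -(map_submx io) !TE map_capmx map_kermx map_diag_mx.
  congr (_ :&: diag_mx _ <= _)%MS; apply/rowP => b.
  by rewrite !mxE rmorph_nat.
pose r := 'C(c + d.-1, c).
have [mon [mon_inj monE]] := monomials_of_degree c d.-1.
case: (resF) => _ _ [v vI] _ _.
(* [v] lifts 1 in S/I to F_0, so the rows of [u] represent the monomials of degree [d.-1]. The
   augmentation returns these exactly, because the error lies in the specialised ideal, which starts
   in degree [d]. *)
pose u : 'M[{mpoly K[c.+1]}]_(r, rk F 0) :=
  homog_part (fun=> d.-1) (@gdeg _ _ F 0) 0 ((\col_a 'X_[mon a]) *m map_mx phi v).
have auE a : (u *m map_mx phi (aug F)) a 0 = 'X_[mon a].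
  rewrite /u -(@homog_part_mulr _ _ _ _ _ _ _ (fun=> 0%N)); last first.
    by apply: homog_mx_spec; exact: (res_aug_homog resF).
  have low : low_zero d ('X_[mon a] * phi (1 - (v *m aug F) 0 0)).
    have [_ _ iM] := low_zero_is_ideal K c.+1 d.
    by apply: iM; apply: lowI; exact: spec_ideal_spec.
  rewrite mxE -mulmxA -map_mxM mxE big_ord1 !mxE !addn0.
  set p := (X in mfilter _ X); have pE : p = 'X_[mon a] -
      'X_[mon a] * phi (1 - (v *m aug F) 0 0).
    by rewrite rmorphB rmorph1 mulrBr mulr1 opprB addrCA subrr addr0 /p !mxE.
  apply/mpolyP => m; rewrite mcoeff_mfilter addn0 pE mcoeffB mcoeffX.
  case: eqP => [mE|ne].
    by rewrite low ?subr0 // mE prednK.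
  by case: eqP => // monm; case: ne; rewrite -monm monE.
have lowD a : low_zero d ((D 0 *m map_mx phi (aug F)) a 0).
  by rewrite -map_mxM mxE; apply: lowI; apply: spec_ideal_spec; exact: res_aug_dif.
have := @homology_bound c K N _ _ D homogD DD0 h _ hh0 hhS N_gt0 d.-1 vanish r u.
rewrite !TE -map_kermx !mxrank_map => /(_ _ _ _)/rank_le_betti.
apply.
- by move=> j i; exact: homog_partP.
- exact: homog_partP.
(* After applying the augmentation, the right side has only terms of degree at least [d], while the
   coefficient of the left side at [mon b] is [mu 0 b]. *)
move=> mu [w wE]; apply/rowP => b; rewrite mxE.
have := congr1 (fun A => (A *m map_mx phi (aug F)) 0 0) wE.
rewrite -!mulmxA !mxE => /(congr1 (mcoeff (mon b))); rewrite !raddf_sum /=.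
rewrite (bigD1 b) //= big1 ?addr0 => [|a ab]; last first.
  by rewrite auE mxE mcoeffCM mcoeffX (inj_eq mon_inj) (negPf ab) mulr0.
rewrite auE mxE mcoeffCM mcoeffX eqxx mulr1 => ->; apply: big1 => a _.
by have [_ _ iM] := low_zero_is_ideal K c.+1 d; apply: iM; rewrite ?lowD ?monE ?prednK.
Qed.

Local Close Scope ring_scope.

Theorem corollary3p7 (k : fieldType) (n : nat) (I : idealr {mpoly k[n]})
    (c d : nat) (F : free_seq k n)
    (homI : homogeneous_ideal I)
    (c_ge2 : 2 <= c) (d_ge1 : 1 <= d)
    (htI : has_height I c)
    (resF : graded_free_resolution I F)
    (NI : condition_N I F d c) :
  'C(d + c - 2, c - 1) <= betti F c.
Proof.
case: htI => htI _; case: c c_ge2 htI NI => // c c_gt0 htI [genI NI].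
have -> : 'C(d + c.+1 - 2, c.+1 - 1) = 'C(c + d.-1, c) by congr 'C(_, _); lia.
apply: (binomial_le_betti homI d_ge1 htI resF genI) => j jd.
(* At homological degree [c.+1] the prescribed maximal shift is [d + c]. *)
apply/eqP/negPn/negP => /(NI c.+1 _).2; rewrite leqnn /= => /(_ isT); lia.
Qed.
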